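(* Let $\mathfrak g$ be a compact simple Lie algebra, $\sigma=\mathrm{Ad}(\exp(\pi/2)\sqrt{-1}K_i)$ with $m_i=3$ or $4$, and $\mathfrak h=\mathfrak g^\sigma$. Then for each automorphism $\mu$ of $\mathfrak g$ with $\mu(\mathfrak h)=\mathfrak h$ we have $\mu\circ\sigma\circ\mu^{-1}=\sigma$ or $\mu\circ\sigma\circ\mu^{-1}=\sigma^{-1}$.
   Context: $\mathfrak t$ is a maximal abelian subalgebra of $\mathfrak g$ (contained in $\mathfrak h$), $\Pi=\{\alpha_1,\dots,\alpha_n\}$ a set of simple roots of $(\mathfrak g_{\mathbb C},\mathfrak t_{\mathbb C})$, $\delta=\sum_jm_j\alpha_j$ the highest root, and $K_j\in\mathfrak t_{\mathbb C}$ is defined by $\alpha_i(K_j)=\delta_{ij}$. $\mathfrak g^\sigma$ is the fixed-point set of $\sigma$ in $\mathfrak g$. *)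

(* Defs.v *)
From HB Require Import structures.
From mathcomp Require Import all_boot all_order all_algebra.
From mathcomp Require Import complex.
From mathcomp Require Import all_classical all_reals all_analysis.

From mathcomp Require Import ring lra.

Set Implicit Arguments.
Unset Strict Implicit.
Unset Printing Implicit Defensive.

Import Order.TTheory GRing.Theory Num.Theory.
Import numFieldNormedType.Exports.

Local Open Scope ring_scope.

HB.mixin Record Vector_isLieAlgebra (F : fieldType) V of Vector F V := {
  lie : V -> V -> V;
  lie_linearl : forall (a : F) (x y z : V),
    lie (a *: x + y) z = a *: lie x z + lie y z;
  lie_linearr : forall (a : F) (x y z : V),
    lie x (a *: y + z) = a *: lie x y + lie x z;
  liexx : forall x : V, lie x x = 0;
  lie_jacobi : forall x y z : V,
    lie x (lie y z) + lie y (lie z x) + lie z (lie x y) = 0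
}.

#[short(type="lieAlgType")]
HB.structure Definition LieAlgebra (F : fieldType) :=
  {V of Vector F V & Vector_isLieAlgebra F V}.

Notation "[lie x , y ]" := (lie x y) (at level 0, format "[lie  x ,  y ]").

Section Trace.
Variables (F : fieldType) (V : vectType F).
Import passmx.

Definition lftrace (f : 'End(V)) : F :=
  \tr (mxof (vbasis {:V}) (vbasis {:V}) f).

Lemma lftraceC (f h : 'End(V)) : lftrace (f \o h)%VF = lftrace (h \o f)%VF.
Proof.
have eV : basis_of {:V} (vbasis {:V}) by exact: vbasisP.
by rewrite /lftrace !(mxof_comp _ _ eV) mxtrace_mulC.
Qed.

Lemma lftraceD (f h : 'End(V)) : lftrace (f + h) = lftrace f + lftrace h.
Proof. by rewrite /lftrace !linearD. Qed.

Lemma lftraceN (f : 'End(V)) : lftrace (- f) = - lftrace f.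
Proof. by rewrite /lftrace !linearN. Qed.

Lemma lftraceZ a (f : 'End(V)) : lftrace (a *: f) = a * lftrace f.
Proof. by rewrite /lftrace !linearZ. Qed.

End Trace.

Section LieAlgebraTheory.
Variables (F : fieldType) (g : lieAlgType F).
Implicit Types (x y : g) (U : {vspace g}).

Lemma lie0r x : [lie x, 0] = 0.
Proof. by have := lie_linearr (-1) x 0 0; rewrite addr0 scaler0 scaleN1r addNr. Qed.

Lemma lie0l x : [lie 0, x] = 0.
Proof. by have := lie_linearl (-1) 0 0 x; rewrite addr0 scaler0 scaleN1r addNr. Qed.

Lemma lieDr x y z : [lie x, y + z] = [lie x, y] + [lie x, z].
Proof. by have := lie_linearr 1 x y z; rewrite !scale1r. Qed.

Lemma lieDl x y z : [lie x + y, z] = [lie x, z] + [lie y, z].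
Proof. by have := lie_linearl 1 x y z; rewrite !scale1r. Qed.

Lemma lieZr a x y : [lie x, a *: y] = a *: [lie x, y].
Proof. by have := lie_linearr a x y 0; rewrite lie0r !addr0. Qed.

Lemma lieZl a x y : [lie a *: x, y] = a *: [lie x, y].
Proof. by have := lie_linearl a x 0 y; rewrite lie0l !addr0. Qed.

Lemma lieNr x y : [lie x, - y] = - [lie x, y].
Proof. by rewrite -scaleN1r lieZr scaleN1r. Qed.

Lemma lieNl x y : [lie - x, y] = - [lie x, y].
Proof. by rewrite -scaleN1r lieZl scaleN1r. Qed.

Lemma lieC x y : [lie x, y] = - [lie y, x].
Proof.
have := liexx (x + y); rewrite lieDl !lieDr !liexx add0r addr0.
by move/eqP; rewrite addr_eq0 => /eqP.
Qed.

Definition ad_fun x (y : g) : g := [lie x, y].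

Fact ad_fun_linear x : linear (ad_fun x).
Proof. by move=> a y z; exact: lie_linearr. Qed.
HB.instance Definition _ x :=
  GRing.isLinear.Build F g g _ (ad_fun x) (ad_fun_linear x).

Definition ad x : 'End(g) := linfun (ad_fun x).

Lemma adE x y : ad x y = [lie x, y].
Proof. by rewrite lfunE. Qed.

Definition lie_ideal U : Prop :=
  forall x y, y \in U -> [lie x, y] \in U.

Definition abelian_sub U : Prop :=
  forall x y, x \in U -> y \in U -> [lie x, y] = 0.

Definition maximal_abelian U : Prop :=
  abelian_sub U /\
  forall U' : {vspace g}, abelian_sub U' -> (U <= U')%VS -> U' = U.

Definition simple_lie : Prop :=
  ~ abelian_sub {:g} /\
  forall U, lie_ideal U -> U = 0%VS \/ U = {:g}%VS.

Definition lie_automorphism (f : 'End(g)) : Prop :=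
  lker f = 0%VS /\ forall x y, f [lie x, y] = [lie f x, f y].

Definition killing x y : F :=
  lftrace (ad x \o ad y)%VF.

Lemma ad_lie x y : ad [lie x, y] = ((ad x \o ad y) - (ad y \o ad x))%VF.
Proof.
apply/lfunP => z; rewrite add_lfunE opp_lfunE !comp_lfunE !adE.
have := lie_jacobi x y z; rewrite [[lie z, x]]lieC [[lie z, _]]lieC lieNr.
by move/eqP; rewrite subr_eq0 => /eqP <-.
Qed.

Lemma killing_lie h x y : killing [lie h, x] y = - killing x [lie h, y].
Proof.
rewrite /killing !ad_lie comp_lfunDl comp_lfunDr comp_lfunNl comp_lfunNr.
rewrite !lftraceD !lftraceN opprB !comp_lfunA; congr (_ - _).
by rewrite -comp_lfunA lftraceC.
Qed.

Lemma killingDl x y z : killing (x + y) z = killing x z + killing y z.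
Proof.
rewrite /killing -lftraceD -comp_lfunDl; congr (lftrace (comp_lfun _ _)).
by apply/lfunP => u; rewrite add_lfunE !adE lieDl.
Qed.

Lemma killingZl a x y : killing (a *: x) y = a * killing x y.
Proof.
have -> : killing (a *: x) y = lftrace (a *: (ad x \o ad y)%VF).
  congr lftrace; apply/lfunP => u.
  by rewrite scale_lfunE !comp_lfunE !adE lieZl.
exact: lftraceZ.
Qed.

Lemma killingC x y : killing x y = killing y x.
Proof. exact: lftraceC. Qed.

End LieAlgebraTheory.

(* This excludes abelian factors: compact means compact semisimple here, which
   is no restriction since the notion is only applied to simple algebras. *)
Definition compact_lie (R : realType) (g : lieAlgType R) : Prop :=
  forall x : g, x != 0 -> killing x x < 0.

(* The pair (x, y) : complexification V stands for x + sqrt(-1) y. *)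
Definition complexification (V : Type) : Type := (V * V)%type.

HB.instance Definition _ (V : zmodType) :=
  GRing.Zmodule.copy (complexification V) (V * V)%type.

Section Coordinates.
Variables (F : fieldType) (V : vectType F).
Import VectorInternalTheory.
Implicit Types (x y : V) (i : 'I_(dim V)).

Lemma v2rP x y : (forall i, v2r x 0 i = v2r y 0 i) -> x = y.
Proof. by move=> xy; apply: v2r_inj; apply/rowP. Qed.

Lemma v2rD x y i : v2r (x + y) 0 i = v2r x 0 i + v2r y 0 i.
Proof. by rewrite linearD mxE. Qed.

Lemma v2rN x i : v2r (- x) 0 i = - v2r x 0 i.
Proof. by rewrite linearN mxE. Qed.

Lemma v2rZ a x i : v2r (a *: x) 0 i = a * v2r x 0 i.
Proof. by rewrite linearZ mxE. Qed.

Lemma v2r0 i : v2r (0 : V) 0 i = 0.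
Proof. by rewrite linear0 mxE. Qed.

Definition v2rE := (v2rD, v2rN, v2rZ, v2r0).

End Coordinates.

Section Complexification.
Variables (R : rcfType) (V : vectType R).
Local Notation VC := (complexification V).
Import VectorInternalTheory.

Definition cscale (c : R[i]) (z : VC) : VC :=
  (complex.Re c *: z.1 - complex.Im c *: z.2, complex.Re c *: z.2 + complex.Im c *: z.1).

Fact cscaleA a b z : cscale a (cscale b z) = cscale (a * b) z.
Proof.
case: a b z => [a a'] [b b'] [x y]; congr pair => /=;
by apply: v2rP => i; rewrite !v2rE; ring.
Qed.

Fact cscale1 : left_id 1 cscale.
Proof.
by case=> x y; rewrite /cscale /= !scale1r !scale0r subr0 addr0.
Qed.

Fact cscaleDr : right_distributive cscale +%R.
Proof.
case=> [a a'] [x y] [x' y']; congr pair => /=;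
by apply: v2rP => i; rewrite !v2rE; ring.
Qed.

Fact cscaleDl z : {morph cscale^~ z : a b / a + b}.
Proof.
case: z => x y [a a'] [b b']; congr pair => /=;
by apply: v2rP => i; rewrite !v2rE; ring.
Qed.

HB.instance Definition _ := GRing.Zmodule_isLmodule.Build R[i] VC
  cscaleA cscale1 cscaleDr cscaleDl.

Fact complexification_vect_iso : Vector.axiom (dim V) VC.
Proof.
pose f (z : VC) : 'rV[R[i]]_(dim V) :=
  \row_j Complex (v2r z.1 0 j) (v2r z.2 0 j).
pose f' (u : 'rV[R[i]]_(dim V)) : VC :=
  (r2v (map_mx (@complex.Re R) u), r2v (map_mx (@complex.Im R) u)).
exists f.
  move=> [a a'] [x y] [x' y']; apply/rowP => j; rewrite !mxE /=.
  by rewrite !v2rE; apply/eqP; rewrite eq_complex /=; apply/andP; split;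
    apply/eqP; ring.
exists f'.
  case=> x y; rewrite /f' /f /=; congr pair; apply: v2r_inj; rewrite r2vK;
  by apply/rowP => j; rewrite !mxE.
by move=> u; apply/rowP => j; rewrite !mxE /= !r2vK !mxE; case: (u 0 j).
Qed.

HB.instance Definition _ := Lmodule_hasFinDim.Build R[i] VC
  complexification_vect_iso.

Definition realpart (z : VC) : V := z.1.

End Complexification.

Section ComplexifiedLie.
Variables (R : rcfType) (g : lieAlgType R).
Local Notation gC := (complexification g).
Import VectorInternalTheory.

Definition clie (z w : gC) : gC :=
  ([lie z.1, w.1] - [lie z.2, w.2], [lie z.1, w.2] + [lie z.2, w.1]).

Fact clie_linearl (a : R[i]) (x y z : gC) :
  clie (a *: x + y) z = a *: clie x z + clie y z.
Proof.
case: a x y z => [a a'] [x x'] [y y'] [z z']; congr pair => /=;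
  rewrite !(lieDl, lieNl, lieZl);
by apply: v2rP => i; rewrite !v2rE; ring.
Qed.

Fact clie_linearr (a : R[i]) (x y z : gC) :
  clie x (a *: y + z) = a *: clie x y + clie x z.
Proof.
case: a x y z => [a a'] [x x'] [y y'] [z z']; congr pair => /=;
  rewrite !(lieDr, lieNr, lieZr);
by apply: v2rP => i; rewrite !v2rE; ring.
Qed.

Fact cliexx (x : gC) : clie x x = 0.
Proof.
by case: x => x y; rewrite /clie /= !liexx subr0 [[lie y, x]]lieC subrr.
Qed.

Fact clie_jacobi (x y z : gC) :
  clie x (clie y z) + clie y (clie z x) + clie z (clie x y) = 0.
Proof.
case: x y z => [x x'] [y y'] [z z'].
have J (a b c : g) i : v2r [lie a, [lie b, c]] 0 i +
    v2r [lie b, [lie c, a]] 0 i + v2r [lie c, [lie a, b]] 0 i = 0.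
  have := congr1 (fun u => v2r u 0 i) (lie_jacobi a b c).
  by rewrite !v2rE.
congr pair => /=; rewrite !(lieDr, lieNr);
  apply: v2rP => i; rewrite !v2rE.
  have := J x y z i; have := J x y' z' i; have := J x' y z' i.
  by have := J x' y' z i; lra.
have := J x' y z i; have := J x y' z i; have := J x y z' i.
by have := J x' y' z' i; lra.
Qed.

HB.instance Definition _ := Vector_isLieAlgebra.Build R[i] gC
  clie_linearl clie_linearr cliexx clie_jacobi.

End ComplexifiedLie.

Section Roots.
Variables (R : rcfType) (g : lieAlgType R) (t : {vspace g}).

(* t_C for a maximal abelian t; roots are linear forms on it. *)
Definition cartan : vectType R[i] := complexification (subvs_of t).

Definition cartan_incl (H : cartan) : complexification g :=
  (vsval H.1, vsval H.2).

Definition cartan_dual : vectType R[i] := 'Hom(cartan, R[i]^o).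

Implicit Types (b d : cartan_dual).

Definition is_root b : Prop :=
  b != 0 /\
  exists2 Z : complexification g,
    Z != 0 & forall H, [lie cartan_incl H, Z] = b H *: Z.

(* Base of the root system: a basis of t_C^* made of roots in which every root
   has integer coordinates of constant sign. *)
Definition is_simple_system n (alpha : n.-tuple cartan_dual) : Prop :=
  [/\ basis_of {:cartan_dual} alpha,
      forall j, is_root (tnth alpha j)
    & forall b, is_root b -> exists c : 'I_n -> nat,
        b = \sum_j tnth alpha j *+ c j \/ b = - \sum_j tnth alpha j *+ c j].

(* Greatest root for the order where b <= d means that d - b is a sum of
   elements of alpha. *)
Definition is_highest_root n (alpha : n.-tuple cartan_dual) d : Prop :=
  is_root d /\
  forall b, is_root b -> exists c : 'I_n -> nat,
    d - b = \sum_j tnth alpha j *+ c j.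

End Roots.

Section Exponential.
Variables (R : realType) (V : vectType R).

(* exp(A) x = sum_k A^k x / k!, summed coordinatewise *)
Definition exp_fun (A : 'End(V)) (x : V) : V :=
  \sum_(j < \dim {:V})
    limn (series (fun k => coord (vbasis {:V}) j (iter k A x) / k`!%:R : R))
      *: (vbasis {:V})`_j.

Lemma is_cvg_exp_coord (A : 'End(V)) (x : V) j :
  cvgn (series (fun k => coord (vbasis {:V}) j (iter k A x) / k`!%:R : R)).
Proof.
set e := vbasis {:V}.
pose N (y : V) : R := \sum_(l < \dim {:V}) `|coord e l y|.
pose M : R := \sum_(p < \dim {:V}) N (A e`_p).
have N_ge0 y : 0 <= N y by exact: sumr_ge0.
have NA y : N (A y) <= M * N y.
  rewrite {1}(coord_vbasis (memvf y)) linear_sum /= /N.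
  rewrite (le_trans (y := \sum_(l < \dim {:V}) \sum_(p < \dim {:V}) `|coord e p y| * `|coord e l (A e`_p)|)) //.
    apply: ler_sum => l _; rewrite linear_sum (le_trans (ler_norm_sum _ _ _)) //.
    by apply: ler_sum => p _; rewrite !linearZ /= normrM.
  rewrite exchange_big /= mulr_sumr; apply: ler_sum => p _.
  rewrite -mulr_sumr mulrC ler_wpM2r //.
  by rewrite /M [leRHS](bigD1 p) //= lerDl sumr_ge0.
have M_ge0 : 0 <= M by exact: sumr_ge0.
have Niter k : N (iter k A x) <= M ^+ k * N x.
  elim: k => [|k IH]; first by rewrite expr0 mul1r.
  by rewrite iterS (le_trans (NA _)) // exprS -mulrA ler_wpM2l.
apply: normed_cvg; apply: (@series_le_cvg _ _ (N x *: exp_coeff M)).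
- by move=> k; exact: normr_ge0.
- by move=> k; rewrite mulr_ge0 ?N_ge0 // exp_coeff_ge0.
- move=> k; rewrite /= normrM normfV normr_nat.
  change (`|coord e j (iter k A x)| / k`!%:R <= N x * (M ^+ k / k`!%:R)).
  rewrite mulrA ler_wpM2r ?invr_ge0 ?ler0n //.
  rewrite mulrC (le_trans _ (Niter k)) // /N [leRHS](bigD1 j) //= lerDl.
  exact: sumr_ge0.
- exact/is_cvg_seriesZ/is_cvg_series_exp_coeff.
Qed.

Fact exp_fun_linear (A : 'End(V)) : linear (exp_fun A).
Proof.
have iterL k a x y : iter k A (a *: x + y) = a *: iter k A x + iter k A y.
  by elim: k => //= k ->; rewrite linearP.
move=> a x y; rewrite /exp_fun scaler_sumr -big_split /=.
apply: eq_bigr => j _; rewrite scalerA -scalerDl; congr (_ *: _).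
pose u z k : R := coord (vbasis {:V}) j (iter k A z) / k`!%:R.
have cu z : cvgn (series (u z)) by exact: is_cvg_exp_coord.
rewrite -/(u _) -[X in limn (series X)]/(u _).
have -> : u (a *: x + y) = a *: u x + u y.
  apply/funext => k; rewrite /u iterL linearP /= mulrDl.
  by rewrite !fctE /GRing.scale /= mulrA.
rewrite seriesD seriesZ limD //; last exact: is_cvgZl_tmp.
by congr (_ + _); exact: limZl_tmp.
Qed.

Definition lfun_exp (A : 'End(V)) : 'End(V) := linfun (exp_fun A).

Lemma lfun_expE (A : 'End(V)) (x : V) : lfun_exp A x = exp_fun A x.
Proof.
pose fL := GRing.isLinear.Build _ _ _ _ (exp_fun A) (exp_fun_linear A).
pose f : {linear _ -> _} := HB.pack (exp_fun A) fL.
exact: (lfunE f).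
Qed.

End Exponential.

(* Ad(exp X) = exp(ad X), so no Lie group is needed. *)
Definition Ad_exp (R : realType) (g : lieAlgType R) (X : g) : 'End(g) :=
  lfun_exp (ad X).

Section Coweights.

Lemma dual_separates (F : fieldType) (V : vectType F) (v : V) :
  (forall f : 'Hom(V, F^o), f v = 0) -> v = 0.
Proof.
move=> fv0; rewrite [LHS](coord_vbasis (memvf _)) big1 // => l _.
pose f : {linear V -> F^o} := coord (vbasis {:V}) l.
by have := fv0 (linfun f); rewrite lfunE => /= ->; rewrite scale0r.
Qed.

Variables (R : realType) (g : lieAlgType R) (t : {vspace g}).

Lemma root_imaginary (b : cartan_dual t) (H : cartan t) :
  compact_lie g -> is_root b -> H.2 = 0 -> complex.Re (b H) = 0.
Proof.
move=> gc [_ [[x y] Z0 /(_ H) +]] H20.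
case: (b H) => a c /= E.
have [E1 E2] : [lie vsval H.1, x] = a *: x - c *: y /\
               [lie vsval H.1, y] = a *: y + c *: x.
  have : clie (cartan_incl H) (x, y) = cscale (Complex a c) (x, y) := E.
  by case; rewrite /= H20 linear0 !lie0l subr0 addr0.
have kx (u : g) : killing [lie vsval H.1, u] u = 0.
  have := killing_lie (vsval H.1) u u; rewrite [killing u _]killingC.
  by move=> ?; lra.
have kN (u v : g) : killing (- u) v = - killing u v.
  by rewrite -scaleN1r killingZl mulN1r.
have := kx x; have := kx y; rewrite E1 E2 !killingDl kN !killingZl.
rewrite [killing y x]killingC ?mulNr => K1 K2.
have kle (u : g) : killing u u <= 0.
  have [->|u0] := eqVneq u 0; last exact/ltW/gc.
  by have := killingZl 0 (0 : g) 0; rewrite scaler0 mul0r => ->.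
have S : killing x x + killing y y < 0.
  move: Z0; rewrite -pair_eqE /= negb_and => /orP[/gc xx|/gc yy].
    by have := kle y; lra.
  by have := kle x; lra.
have : a * (killing x x + killing y y) = 0 by lra.
by move/eqP; rewrite mulf_eq0 (negbTE (ltr0_neq0 S)) orbF => /eqP.
Qed.

(* sqrt(-1) K_k lies in the real form t, hence equals its real part; this is
   what makes Ad_exp (vsval (realpart ('i%C *: K k))) the map
   Ad(exp(sqrt(-1) K_k)) of g. *)
Lemma coweight_imaginary n (alpha : n.-tuple (cartan_dual t))
    (K : 'I_n -> cartan t) :
  compact_lie g -> is_simple_system alpha ->
  (forall j k, tnth alpha j (K k) = (j == k)%:R) ->
  forall k, 'i%C *: K k = (realpart ('i%C *: K k), 0).
Proof.
move=> gc [aB aR _] aK k.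
have incl_i (x : subvs_of t) : 'i%C *: ((x, 0) : cartan t) = (0, x).
  by rewrite /GRing.scale /= /cscale /= !scale0r !scale1r subr0 add0r.
case E : (K k) => [p q].
suff p0 : p = 0.
  rewrite p0 /realpart /GRing.scale /= /cscale /=.
  by rewrite !scale0r !scale1r sub0r addr0.
have a0 j : tnth alpha j (p, 0) = 0.
  have Ip := root_imaginary gc (aR j) (erefl : ((p, 0) : cartan t).2 = 0).
  have Iq := root_imaginary gc (aR j) (erefl : ((q, 0) : cartan t).2 = 0).
  have := aK j k; rewrite E.
  have -> : (p, q) = (p, 0) + 'i%C *: ((q, 0) : cartan t) :> cartan t.
    by rewrite incl_i; congr pair; rewrite /= ?addr0 ?add0r.
  rewrite linearD linearZ /=.
  move: Ip Iq; case: (tnth alpha j _) => a b; case: (tnth alpha j _) => c d /=.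
  move=> -> ->; rewrite /GRing.scale /=; case: (j == k) => -[] _; simpc => ->;
  by [].
have b0 (b : cartan_dual t) : b (p, 0) = 0.
  rewrite (coord_basis aB (memvf b)) sum_lfunE big1 // => j _.
  by rewrite scale_lfunE -tnth_nth a0 scaler0.
have : ((p, 0) : cartan t) = 0 by exact: dual_separates.
by case.
Qed.
End Coweights.

(* Main.v *)
Require Import Defs.
From HB Require Import structures.
From mathcomp Require Import all_boot all_order all_algebra.
From mathcomp Require Import complex.
From mathcomp Require Import all_classical all_reals all_analysis.
From mathcomp Require Import ring lra.

(** The eigenvalue of sigma on the root space of b is a power of sqrt(-1): the
    exponent is the coefficient of alpha_i in b. So sigma fixes t and the
    simple root vectors other than e_i, and sends e_i to sqrt(-1) e_i.

    Put tau = mu sigma mu^-1. As mu preserves h, tau fixes h pointwise, hence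
    t and all e_j with j <> i. Fixing t, it preserves the root space of
    alpha_i, which is a line ([weight_colinear]), so tau e_i = c e_i. An
    automorphism that fixes t and all the e_j is the identity
    ([simple_vectors_generate]). Applied to sigma^4, this gives sigma^4 = 1,
    so tau^4 = 1 and c^4 = 1. If c^2 = 1 it gives tau^2 = 1, which would make
    sigma^2 = 1, although sigma^2 e_i = - e_i. So c is sqrt(-1) or
    - sqrt(-1), and the same principle applied to tau sigma^3, respectively to
    tau sigma, gives tau = sigma, respectively tau = sigma^-1
    ([order4_rigid]).

    The two facts about root vectors rest on the compactness of g rather than
    on the theory of root systems. The complexified Killing form and the
    conjugation of g_C give a positive Hermitian square norm N with the
    following property: if e has weight a, v has weight b, and the conjugate
    of e kills v, then N [e, v] = b(h_e) N v, where h_e is the bracket of e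
    and its conjugate ([hnorm_lie]); moreover a(h_e) < 0 when a is a root
    ([coroot_self_lt0]). If e and v are nonzero orthogonal vectors of one
    root space, the conjugate of e kills v, so N [e, v] would be negative: root
    spaces are lines. A lowest vector of positive weight b, killed by the
    conjugates of all e_j, would have b(h_j) >= 0 for all j, which contradicts
    b(h_v) < 0 because b is a nonnegative combination of simple roots. For an
    automorphism f fixing t and the e_j, induction on the height of b makes
    f v - v such a lowest vector, so f v = v.

    That weight vectors span g_C ([weight_ind]) and that sigma respects
    brackets ([Ad_exp_lie]) both come from diagonalizing ad t. *)

Set Implicit Arguments.
Unset Strict Implicit.
Unset Printing Implicit Defensive.

Import Order.TTheory GRing.Theory Num.Theory.

Local Open Scope ring_scope.

(** * Common eigenvectors of commuting endomorphisms *)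

Section CommonEigenvector.
Variable C : numClosedFieldType.
Import passmx.

Lemma common_eigenvector_full (V : vectType C) (fs : seq 'End(V)) :
    {:V}%VS != 0%VS ->
    {in fs &, forall f g : 'End(V), forall v, f (g v) = g (f v)} ->
  exists2 v : V, v != 0 & {in fs, forall f : 'End(V), exists a, f v = a *: v}.
Proof.
move=> V0 fC; set e := vbasis {:V}.
have eb : basis_of {:V} e by exact: vbasisP.
have d0 : (0 < \dim {:V})%N by rewrite lt0n dimv_eq0.
have [|u u0 /allP uP] := @common_eigenvector C _ (map (mxof e e) fs) d0.
  move=> _ _ /mapP[f ff ->] /mapP[g gg ->].
  rewrite /comm_mx -!(mxof_comp _ _ eb); congr mxof.
  by apply/lfunP => v; rewrite !lfunE /= fC.
exists (vecof e u); first by rewrite vecof_eq0 // (basis_free eb).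
move=> f ff.
have /eigenvectorP[a /eigenspaceP ua] := uP _ (map_f (mxof e e) ff).
exists a; rewrite -linearZ /= -ua (vecof_mul eb eb) (mxofK eb eb).
by [].
Qed.

Lemma common_eigenvector_in (V : vectType C) (U : {vspace V})
    (fs : seq 'End(V)) :
    U != 0%VS ->
    {in fs &, forall f g : 'End(V), forall v, f (g v) = g (f v)} ->
    {in fs, forall (f : 'End(V)) v, v \in U -> f v \in U} ->
  exists2 v, v \in U & v != 0 /\
    {in fs, forall f : 'End(V), exists a, f v = a *: v}.
Proof.
move=> U0 fC fU.
(* restrict all the endomorphisms to U, where a common eigenvector exists *)
pose r (f : 'End(V)) : 'End(subvs_of U) := linfun (vsproj U \o (f \o vsval)).
have rE f w : f \in fs -> vsval (r f w) = f (vsval w).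
  by move=> ff; rewrite lfunE /= vsprojK // fU // subvsP.
have [||w w0 wP] := @common_eigenvector_full _ (map r fs).
- by rewrite -dimv_eq0 dimvf /dim /= dimv_eq0.
- move=> _ _ /mapP[f ff ->] /mapP[g gg ->] v.
  by apply: val_inj; rewrite /= !rE //= fC.
exists (vsval w); first exact: subvsP.
split; first by apply: contra w0 => /eqP w0; apply/eqP/val_inj; rewrite /= w0.
move=> f ff; have [a ra] := wP _ (map_f r ff).
by exists a; rewrite -rE // ra linearZ.
Qed.

End CommonEigenvector.

(** * The complexified Lie algebra and its Hermitian norm *)

Section KillingLinear.
Variables (F : fieldType) (g : lieAlgType F).
Implicit Types x y z : g.

Lemma killingDr x y z : killing x (y + z) = killing x y + killing x z.
Proof. by rewrite !(killingC x) killingDl. Qed.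

Lemma killingNl x y : killing (- x) y = - killing x y.
Proof. by rewrite -scaleN1r killingZl mulN1r. Qed.

Lemma killingNr x y : killing x (- y) = - killing x y.
Proof. by rewrite !(killingC x) killingNl. Qed.

Lemma lie_jacobiE x y z :
  [lie x, [lie y, z]] = [lie [lie x, y], z] + [lie y, [lie x, z]].
Proof.
by rewrite -(adE [lie x, y]) ad_lie add_lfunE opp_lfunE !comp_lfunE !adE addrNK.
Qed.

End KillingLinear.

Section Complexified.
Local Open Scope complex_scope.
Variables (R : rcfType) (g : lieAlgType R).
Local Notation gC := (complexification g).
Implicit Types (z w u : gC) (f : 'End(g)).

Definition conjg z : gC := (z.1, - z.2).

Lemma conjgK : involutive conjg.
Proof. by case=> x y; rewrite /conjg /= opprK. Qed.

Lemma conjgD z w : conjg (z + w) = conjg z + conjg w.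
Proof. by case: z w => [x x'] [y y']; congr pair; rewrite /= ?opprD. Qed.

Lemma conjgZ a z : conjg (a *: z) = conjc a *: conjg z.
Proof.
case: a z => [a a'] [x x']; congr pair => /=.
  by rewrite scaleNr scalerN !opprK.
by rewrite scaleNr scalerN opprD.
Qed.

Lemma conjg_lie z w : conjg [lie z, w] = [lie conjg z, conjg w].
Proof.
case: z w => [x x'] [y y']; congr pair; rewrite /= ?(lieNl, lieNr) ?opprK //.
by rewrite opprD.
Qed.

Definition cmap f z : gC := (f z.1, f z.2).

Lemma cmapP f a z w : cmap f (a *: z + w) = a *: cmap f z + cmap f w.
Proof.
case: a z w => [a a'] [x x'] [y y']; congr pair => /=;
  by rewrite !(linearD, linearN, linearZ).
Qed.

Lemma cmapZ f a z : cmap f (a *: z) = a *: cmap f z.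
Proof.
have -> : a *: z = a *: z + 0 by rewrite addr0.
by rewrite cmapP /cmap !linear0; exact: addr0.
Qed.

Lemma cmap_conjg f z : cmap f (conjg z) = conjg (cmap f z).
Proof. by rewrite /cmap /conjg /= linearN. Qed.

Lemma cmap_comp f f' z : cmap (f \o f')%VF z = cmap f (cmap f' z).
Proof. by rewrite /cmap !comp_lfunE. Qed.

Lemma cmap_inj f f' : cmap f =1 cmap f' -> f = f'.
Proof. by move=> ff'; apply/lfunP => x; exact: (congr1 fst (ff' (x, 0))). Qed.

Lemma cmap_lie f : (forall x y, f [lie x, y] = [lie f x, f y]) ->
  forall z w, cmap f [lie z, w] = [lie cmap f z, cmap f w].
Proof.
by move=> fL [x x'] [y y']; congr pair; rewrite /= !(linearB, linearD) /= !fL.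
Qed.

(** The C-bilinear extension of the Killing form of g. It is built from the
    two coordinates rather than as a trace on g_C, so that its positivity is
    read off from g. *)
Definition cform z w : R[i] :=
  (killing z.1 w.1 - killing z.2 w.2) +i* (killing z.1 w.2 + killing z.2 w.1).

Lemma cformC z w : cform z w = cform w z.
Proof.
rewrite /cform (killingC z.1 w.1) (killingC z.2 w.2) (killingC z.1 w.2).
by rewrite (killingC z.2 w.1); congr Complex; exact: addrC.
Qed.

Lemma cformPl a z w u : cform (a *: z + w) u = a * cform z u + cform w u.
Proof.
case: a z w u => [a a'] [x x'] [y y'] [v v']; apply/eqP; rewrite eq_complex /=.
rewrite !(killingDl, killingNl, killingZl).
by apply/andP; split; apply/eqP; ring.
Qed.

Lemma cform0l u : cform 0 u = 0.
Proof. by have := cformPl (-1) 0 0 u; rewrite scaler0 addr0 mulN1r addNr. Qed.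

Lemma cformZl a z u : cform (a *: z) u = a * cform z u.
Proof. by rewrite -[a *: z]addr0 cformPl cform0l addr0. Qed.

Lemma cformNl z u : cform (- z) u = - cform z u.
Proof. by rewrite -scaleN1r cformZl mulN1r. Qed.

Lemma cformZr a z u : cform u (a *: z) = a * cform u z.
Proof. by rewrite !(cformC u) cformZl. Qed.

Lemma cformNr z u : cform u (- z) = - cform u z.
Proof. by rewrite !(cformC u) cformNl. Qed.

Lemma cform_lie z w u : cform [lie z, w] u = - cform w [lie z, u].
Proof.
case: z w u => [x x'] [y y'] [v v']; apply/eqP; rewrite eq_complex /=.
rewrite !(killingDl, killingNl, killingDr, killingNr) !killing_lie.
by apply/andP; split; apply/eqP; ring.
Qed.

Definition hnorm z : R[i] := - cform z (conjg z).

(** The square norm of x + sqrt(-1) y is - (B(x, x) + B(y, y)), so the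
    compactness of g makes it positive. *)
Lemma hnormE z : hnorm z = (- (killing z.1 z.1 + killing z.2 z.2))%:C.
Proof.
apply/eqP; rewrite /hnorm eq_complex /= !killingNr opprK (killingC z.2) addNr.
by rewrite oppr0 !eqxx.
Qed.

End Complexified.

Section Compact.
Variables (R : realType) (g : lieAlgType R).
Hypothesis gc : compact_lie g.
Implicit Types (z : complexification g).

Lemma hnorm_gt0 z : z != 0 -> 0 < hnorm z.
Proof.
have kle (u : g) : killing u u <= 0.
  by have [->|/gc/ltW//] := eqVneq u 0; rewrite -(scale0r 0) killingZl mul0r.
rewrite hnormE ltcE /= eqxx /= oppr_gt0; case: z => x y.
rewrite -pair_eqE /= negb_and => /orP[/gc xx|/gc yy].
  by have := kle y; lra.
by have := kle x; lra.
Qed.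

Lemma hnorm_ge0 z : 0 <= hnorm z.
Proof.
have [->|/hnorm_gt0/ltW//] := eqVneq z 0.
by rewrite /hnorm cform0l oppr0.
Qed.

End Compact.

(** * Weight vectors of a maximal abelian subalgebra *)

Section Weights.
Local Open Scope complex_scope.
Variables (R : realType) (g : lieAlgType R) (t : {vspace g}).
Hypotheses (gc : compact_lie g) (tmax : maximal_abelian t).
Local Notation gC := (complexification g).
Implicit Types (z w v : gC) (H : cartan t) (b d : cartan_dual t).

(** The zero form is allowed as a weight, and the zero vector has every
    weight: statements about brackets of weight vectors then need no case
    distinction. *)
Definition weight b z := forall H, [lie cartan_incl H, z] = b H *: z.

Definition conj_cartan H : cartan t := (H.1, - H.2).

Lemma conjg_incl H : conjg (cartan_incl H) = cartan_incl (conj_cartan H).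
Proof. by congr pair. Qed.

Lemma cartan_inclP a H H' :
  cartan_incl (a *: H + H') = a *: cartan_incl H + cartan_incl H'.
Proof.
case: a H H' => [a a'] [x x'] [y y']; congr pair => /=;
  by rewrite !(linearD, linearN, linearZ).
Qed.

Lemma cartan_incl0 : cartan_incl (0 : cartan t) = 0.
Proof. by congr pair; exact: linear0. Qed.

Lemma cartan_incl_abelian H H' : [lie cartan_incl H, cartan_incl H'] = 0.
Proof.
have [tab _] := tmax.
by congr pair; rewrite /= !tab ?subvsP // ?subrr ?addr0.
Qed.

Lemma centralizer_t (x : g) : (forall y, y \in t -> [lie y, x] = 0) -> x \in t.
Proof.
move=> tx; have [tab tM] := tmax.
suff tx' : abelian_sub (t + <[x]>)%VS.
  have <- := tM _ tx' (addvSl _ _).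
  by rewrite (subvP (addvSr _ _)) ?memv_line.
move=> y1 y2 /memv_addP[y yt [_ /vlineP[a ->] ->]].
move=> /memv_addP[y' yt' [_ /vlineP[a' ->] ->]].
rewrite !(lieDl, lieDr, lieZl, lieZr) liexx (tx y) // (lieC x) (tx y') //.
rewrite (tab y y') //.
by rewrite oppr0 !scaler0 !addr0.
Qed.

(** A maximal abelian t is its own centralizer in g, and the centralizer of t
    in g_C is the complexification of that of t in g. *)
Lemma weight0P z : weight 0 z <-> exists H, z = cartan_incl H.
Proof.
split=> [z0|[H' ->] H]; last by rewrite cartan_incl_abelian lfunE /= scale0r.
have zt : z.1 \in t /\ z.2 \in t.
  split; apply: centralizer_t => y yt.
    have := z0 ((vsproj t y, 0) : cartan t); rewrite lfunE /= scale0r.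
    by case=> + _; rewrite /= vsprojK // lie0l subr0.
  have := z0 ((vsproj t y, 0) : cartan t); rewrite lfunE /= scale0r.
  by case=> _; rewrite /= vsprojK // lie0l addr0.
exists (vsproj t z.1, vsproj t z.2).
by rewrite /cartan_incl /= !vsprojK ?zt.1 ?zt.2 //; case: (z).
Qed.

Lemma weight_lin b a z w : weight b z -> weight b w -> weight b (a *: z + w).
Proof.
by move=> bz bw H; rewrite lieDr lieZr bz bw scalerDr !scalerA [b H * a]mulrC.
Qed.

Lemma weight_lie b d z w :
  weight b z -> weight d w -> weight (b + d) [lie z, w].
Proof.
move=> bz dw H; rewrite lie_jacobiE bz dw lieZl lieZr add_lfunE.
by rewrite scalerDl.
Qed.

Lemma weight_imaginary b z (x : subvs_of t) : z != 0 -> weight b z ->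
  complex.Re (b ((x, 0) : cartan t)) = 0.
Proof.
move=> z0 bz; have [->|b0] := eqVneq b 0; first by rewrite lfunE.
by apply: root_imaginary => //; split=> //; exists z.
Qed.

(** Roots are imaginary on t, so conj (b (conj H)) = - b H. *)
Lemma weight_conjg b z : weight b z -> weight (- b) (conjg z).
Proof.
move=> bz; have [->|z0] := eqVneq z 0.
  by move=> H; rewrite /conjg /= oppr0 lie0r scaler0.
have bi (x : subvs_of t) := weight_imaginary x z0 bz.
have bconj H : conjc (b (conj_cartan H)) = - b H.
  case: H => x y; have := bi x; have := bi y.
  have incl_i c : (0 +i* c) *: ((y, 0) : cartan t) = (0, c *: y).
    rewrite [LHS]/GRing.scale /= /Defs.cscale /=.
    by rewrite !scale0r scaler0 subr0 add0r.
  have -> : (x, y) = (0 +i* 1) *: ((y, 0) : cartan t) + (x, 0) :> cartan t.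
    by rewrite incl_i scale1r; congr pair; rewrite /= ?addr0 ?add0r.
  have -> : conj_cartan ((0 +i* 1) *: ((y, 0) : cartan t) + (x, 0))
      = (0 +i* (-1)) *: ((y, 0) : cartan t) + (x, 0) :> cartan t.
    by rewrite !incl_i scaleN1r scale1r; congr pair; rewrite /= ?addr0 ?add0r.
  rewrite !linearP /= /GRing.scale /=.
  case: (b _) => p q; case: (b _) => p' q' /= -> ->.
  by apply/eqP; rewrite eq_complex /=; apply/andP; split; apply/eqP; ring.
move=> H; have := congr1 (@conjg _ _) (bz (conj_cartan H)).
rewrite conjg_lie conjgZ bconj conjg_incl opp_lfunE.
suff -> : conj_cartan (conj_cartan H) = H by [].
by case: H => x y; rewrite /conj_cartan /= opprK.
Qed.

(** The weight is recovered from a common eigenvector z as the Rayleigh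
    quotient of ad H at z, which is visibly linear in H. *)
Lemma exists_weight (U : {vspace gC}) : U != 0%VS ->
    (forall H z, z \in U -> [lie cartan_incl H, z] \in U) ->
  exists2 z, z \in U /\ z != 0 & exists b, weight b z.
Proof.
move=> U0 UH; pose e := vbasis {:cartan t}.
have [|f|z zU [z0 zP]] := @common_eigenvector_in _ _ U
    [seq ad (cartan_incl H) | H <- e] U0.
- move=> _ _ /mapP[H _ ->] /mapP[H' _ ->] w; rewrite !adE lie_jacobiE.
  by rewrite cartan_incl_abelian lie0l add0r.
- by move=> /mapP[H _ ->] w wU; rewrite adE UH.
exists z => //; pose N := cform z (conjg z).
have N0 : N != 0.
  by have := hnorm_gt0 gc z0; rewrite /hnorm lt_def oppr_eq0 => /andP[].
pose f H : R[i]^o := cform [lie cartan_incl H, z] (conjg z) / N.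
have fl : linear f.
  move=> a H H'; rewrite /f cartan_inclP lieDl lieZl cformPl mulrDl -mulrA.
  by [].
pose fL := GRing.isLinear.Build _ _ _ _ f fl.
pose F : {linear cartan t -> R[i]^o} := HB.pack f fL.
exists (linfun F) => H; rewrite lfunE /= /f.
suff [a ->] : exists a, [lie cartan_incl H, z] = a *: z.
  by rewrite cformZl mulfK.
rewrite (coord_vbasis (memvf H)); elim/big_rec: _ => [|j H' _ [a aE]].
  by exists 0; rewrite cartan_incl0 lie0l scale0r.
have [c] : exists c, ad (cartan_incl e`_j) z = c *: z.
  by apply: zP; apply: map_f; apply: mem_nth; rewrite size_tuple.
rewrite adE => cE; exists (coord (vbasis fullv) j H * c + a).
by rewrite cartan_inclP lieDl lieZl cE aE scalerDl scalerA.
Qed.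

Lemma exists_orthogonal (U : {vspace gC}) : U != {:gC}%VS ->
  exists2 W : {vspace gC}, W != 0%VS &
    forall z, z \in W <-> forall w, w \in U -> cform z (conjg w) = 0.
Proof.
move=> UT.
pose f z : 'rV[R[i]]_(\dim U) := \row_j cform z (conjg (vbasis U)`_j).
have fl : linear f.
  by move=> a z w; apply/rowP => j; rewrite !mxE cformPl.
pose fL := GRing.isLinear.Build _ _ _ _ f fl.
pose F : {linear gC -> 'rV[R[i]]_(\dim U)} := HB.pack f fL.
exists (lker (linfun F)).
  apply: contra UT => /eqP F0; rewrite eqEdim subvf /=.
  rewrite -(limg_ker_dim (linfun F) fullv) F0 capv0 dimv0 add0n.
  by rewrite (leq_trans (dimvS (subvf _))) // dimvf /dim /= mul1n.
move=> z; rewrite memv_ker lfunE; split=> [/eqP/rowP zU w wU|zU].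
  rewrite (coord_vbasis wU); elim/big_rec: _ => [|j w' _ w'0].
    by rewrite /conjg /= oppr0 cformC cform0l.
  have := zU j; rewrite !mxE => zj.
  by rewrite conjgD conjgZ cformC cformPl !(cformC _ z) zj w'0 mulr0 addr0.
apply/eqP/rowP => j; rewrite !mxE zU //.
by apply: vbasis_mem; apply: mem_nth; rewrite size_tuple.
Qed.

(** The root space decomposition, stated as an induction principle: g_C is
    spanned by weight vectors. Take an ad t-stable subspace on which P is
    known; if it is proper, its orthogonal for the Hermitian form is nonzero and
    ad t-stable, hence contains a weight vector, which is not in the subspace
    and can be adjoined. *)
Lemma weight_ind (P : gC -> Prop) :
    (forall a z w, P z -> P w -> P (a *: z + w)) ->
    (forall b z, weight b z -> P z) ->
  forall z, P z.
Proof.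
move=> PL Pw.
suff [U [_ UP UT]] : exists U : {vspace gC},
    [/\ forall H z, z \in U -> [lie cartan_incl H, z] \in U,
        forall z, z \in U -> P z & U != {:gC}%VS -> (\dim {:gC} <= \dim U)%N].
  move=> z; apply: UP; suff -> : U = {:gC}%VS by rewrite memvf.
  apply/eqP; apply: contraT => /[dup] /UT UT'.
  by rewrite eqEdim subvf UT'.
elim: (\dim {:gC}) => [|k [U [UH UP Uk]]].
  exists 0%VS; split=> // [H z|z]; rewrite memv0 => /eqP ->.
    by rewrite lie0r mem0v.
  by apply: (Pw 0) => H; rewrite lie0r scaler0.
have [UT|UT] := eqVneq U {:gC}%VS.
  by exists U; split=> //; rewrite UT eqxx.
have [W W0 WP] := exists_orthogonal UT.
have [H z /WP zW|v [/WP vW v0] [b bv]] := exists_weight W0.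
  apply/WP => w wU; rewrite cform_lie.
  rewrite cformC -[cartan_incl H]conjgK conjg_incl -conjg_lie cformC.
  rewrite zW ?oppr0 //.
  exact: UH.
have vU : v \notin U.
  apply/negP => /vW vv; have := hnorm_gt0 gc v0.
  by rewrite /hnorm vv oppr0 ltxx.
exists (U + <[v]>)%VS; split.
- move=> H _ /memv_addP[u uU [_ /vlineP[a ->] ->]].
  rewrite lieDr lieZr bv memv_add ?UH // !rpredZ //.
  exact: memv_line.
- move=> _ /memv_addP[u uU [_ /vlineP[a ->] ->]].
  by rewrite addrC; apply: PL; [exact: Pw bv | exact: UP].
move=> _; apply: leq_ltn_trans (Uk UT) _.
rewrite ltn_neqAle dimvS ?addvSl // andbT; apply: contra vU => /eqP dU.
have /eqP -> : U == (U + <[v]>)%VS by rewrite eqEdim addvSl dU leqnn.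
by rewrite (subvP (addvSr _ _)) ?memv_line.
Qed.

(** By [cform_coroot] this H represents a multiple of the root of z for the
    Killing form: it is a coroot up to normalization. *)
Definition coroot z H := [lie z, conjg z] = cartan_incl H.

Lemma exists_coroot b z : weight b z -> exists H, coroot z H.
Proof.
move=> bz; apply/weight0P; rewrite -(subrr b).
exact: weight_lie bz (weight_conjg bz).
Qed.

(** B(H', [z, conj z]) = B([H', z], conj z) = b(H') B(z, conj z). *)
Lemma cform_coroot b z H H' : weight b z -> coroot z H ->
  cform (cartan_incl H') (cartan_incl H) = - (b H' * hnorm z).
Proof.
move=> bz <-; rewrite /hnorm mulrN opprK -cformZl -bz.
by rewrite (lieC (cartan_incl H')) cformNl cform_lie opprK.
Qed.

Lemma coroot_sym b d z w H H' :
    weight b z -> weight d w -> coroot z H -> coroot w H' ->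
  b H' * hnorm z = d H * hnorm w.
Proof.
move=> bz dw zH wH; apply: oppr_inj.
by rewrite -(cform_coroot _ bz zH) -(cform_coroot _ dw wH) cformC.
Qed.

(** Apply [cform_coroot] to H itself: the bracket of z and its conjugate is
    anti-invariant under conjugation, so its Killing square is its square
    norm. *)
Lemma coroot_self b z H : weight b z -> coroot z H ->
  b H * hnorm z = - hnorm (cartan_incl H).
Proof.
move=> bz zH; apply: oppr_inj; rewrite -(cform_coroot _ bz zH) opprK /hnorm.
by rewrite -[in X in conjg X]zH conjg_lie conjgK lieC zH cformNr opprK.
Qed.

Lemma coroot_neq0 b z H : b != 0 -> weight b z -> z != 0 -> coroot z H ->
  cartan_incl H != 0.
Proof.
move=> b0 bz z0 zH; apply: contra b0 => /eqP H0.
apply/eqP/lfunP => H'; rewrite lfunE /=; apply/eqP.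
have := cform_coroot H' bz zH; rewrite H0 cformC cform0l => /eqP.
by rewrite eq_sym oppr_eq0 mulf_eq0 (gt_eqF (hnorm_gt0 gc z0)) orbF.
Qed.

Lemma coroot_self_lt0 b z H : b != 0 -> weight b z -> z != 0 -> coroot z H ->
  b H < 0.
Proof.
move=> b0 bz z0 zH; rewrite -(pmulr_llt0 _ (hnorm_gt0 gc z0)).
by rewrite (coroot_self bz zH) oppr_lt0 hnorm_gt0 // (coroot_neq0 b0 bz z0 zH).
Qed.

(** The sl2-type estimate behind all positivity arguments below. Moving e across
    the form turns N [e, v] into B(v, [e, [conj e, conj v]]), where the Jacobi
    identity leaves only the bracket with [e, conj e], because
    [e, conj v] is the conjugate of [conj e, v] = 0. *)
Lemma hnorm_lie d e v H : weight d v -> coroot e H -> [lie conjg e, v] = 0 ->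
  hnorm [lie e, v] = d H * hnorm v.
Proof.
move=> dv eH ev0; rewrite /hnorm conjg_lie cform_lie lie_jacobiE.
have -> : [lie e, conjg v] = 0.
  by rewrite -[e]conjgK -conjg_lie ev0 /conjg /= oppr0.
rewrite lie0r addr0 eH !opprK -[LHS]opprK -cform_lie dv cformZl.
by rewrite mulrN.
Qed.

End Weights.

(** * Root spaces and generation by simple root vectors *)

Section Simple.
Local Open Scope complex_scope.
Variables (R : realType) (g : lieAlgType R) (t : {vspace g}).
Hypotheses (gc : compact_lie g) (tmax : maximal_abelian t).
Local Notation gC := (complexification g).
Implicit Types (z w v : gC) (H : cartan t) (b d : cartan_dual t).

(** Root spaces are lines. The component v of w orthogonal to z satisfies
    [conj z, v] = 0, since this bracket lies in t_C and is orthogonal to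
    t_C. Then N [z, v] = b(h_z) N v with b(h_z) < 0, so v = 0. *)
Lemma weight_colinear b z w : b != 0 -> z != 0 -> weight b z -> weight b w ->
  exists c, w = c *: z.
Proof.
move=> b0 z0 bz bw; pose N := hnorm z.
have N0 : N != 0 by rewrite gt_eqF // hnorm_gt0.
pose c := - (cform w (conjg z) / N); exists c.
(* c is chosen so that v is orthogonal to z *)
pose v := - c *: z + w.
suff v0 : v = 0 by apply/eqP; rewrite -subr_eq0 -scaleNr addrC -/v v0.
have bv : weight b v by exact: weight_lin.
have vz : cform (conjg z) v = 0.
  rewrite cformC /v cformPl /c opprK.
  have -> : cform z (conjg z) = - N by rewrite /N /hnorm opprK.
  by rewrite mulrN divfK // addNr.
have [H zH] := exists_coroot gc tmax bz.
have zv : [lie conjg z, v] = 0.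
  have := weight_lie (weight_conjg gc bz) bv.
  rewrite addNr => /(weight0P tmax)[H' H'E].
  apply/eqP; apply: contraT => /(hnorm_gt0 gc).
  rewrite /hnorm {2}H'E conjg_incl cform_lie (lieC (conjg z)).
  rewrite (weight_conjg gc bz) cformNr cformZr (cformC v) vz.
  by rewrite mulr0 !oppr0 ltxx.
apply/eqP; apply: contraT => v0.
have := coroot_self_lt0 gc b0 bz z0 zH.
rewrite -(pmulr_llt0 _ (hnorm_gt0 gc v0)) -(hnorm_lie bv zH zv).
by move=> vl; have := le_lt_trans (hnorm_ge0 gc _) vl; rewrite ltxx.
Qed.

Variables (n : nat) (alpha : n.-tuple (cartan_dual t)) (K : 'I_n -> cartan t).
Hypothesis alpha_simple : is_simple_system alpha.
Hypothesis alphaK : forall j k, tnth alpha j (K k) = (j == k)%:R.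
Local Notation nneg c := (\sum_j tnth alpha j *+ c j).

Lemma nnegE c H : nneg c H = \sum_j tnth alpha j H *+ c j.
Proof.
rewrite sum_lfunE; apply: eq_bigr => j _.
elim: (c j) => [|k IHk]; first by rewrite !mulr0n lfunE.
by rewrite !mulrS add_lfunE IHk.
Qed.

Lemma nnegK (c : 'I_n -> nat) k : nneg c (K k) = (c k)%:R.
Proof.
rewrite nnegE (bigD1 k) //= big1 ?addr0; first by rewrite alphaK eqxx.
by move=> j /negbTE jk; rewrite alphaK jk mul0rn.
Qed.

Lemma nneg_eq0 (c : 'I_n -> nat) : (\sum_j c j)%N = 0%N -> nneg c = 0.
Proof.
move=> /eqP; rewrite sum_nat_eq0 => /forallP c0.
by rewrite big1 // => j _; rewrite (eqP (c0 j)) mulr0n.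
Qed.

Lemma root_sign b z : b != 0 -> z != 0 -> weight b z ->
  exists c, b = nneg c \/ b = - nneg c.
Proof.
by move=> b0 z0 bz; have [_ _] := alpha_simple; apply; split=> //; exists z.
Qed.

(** Subtracting a simple root from a positive weight lowers the height or leaves
    the set of weights. If alpha_j does not occur in it, the difference
    has coefficient -1 at alpha_j, so it is negative, and then all other
    coefficients vanish too. *)
Lemma nneg_sub_simple (c : 'I_n -> nat) j z : nneg c != 0 -> z != 0 ->
    weight (nneg c - tnth alpha j) z ->
  exists2 c', nneg c - tnth alpha j = nneg c' & (\sum_k c' k < \sum_k c k)%N.
Proof.
move=> c0 z0 cz; have [cj0|cj0] := posnP (c j); last first.
  (* truncation is harmless, as c j is positive here *)
  exists (fun k => c k - (k == j))%N.
    apply/eqP; rewrite subr_eq (bigD1 j) //= [X in _ == X + _](bigD1 j) //=.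
    rewrite eqxx addrAC -mulrSr subn1 prednK //; apply/eqP; congr (_ + _).
    by apply: eq_bigr => k /negbTE ->; rewrite subn0.
  rewrite (bigD1 j) //= [ltnRHS](bigD1 j) //= eqxx subn1.
  under eq_bigr => k /negbTE -> do rewrite subn0.
  by rewrite ltn_add2r prednK.
have evK (b : cartan_dual t) k :
    nneg c - tnth alpha j = b -> (c k)%:R = b (K k) + (j == k)%:R :> R[i].
  by move=> <-; rewrite add_lfunE opp_lfunE nnegK alphaK subrK.
have d0 : nneg c - tnth alpha j != 0.
  apply/eqP => /(evK _ j); rewrite cj0 lfunE /= eqxx add0r => /eqP.
  by rewrite eqr_nat.
have [c' [cE|cE]] := root_sign d0 z0 cz.
  have := evK _ j cE; rewrite nnegK cj0 eqxx -natrD => /eqP.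
  by rewrite eqr_nat addn1.
case/eqP: c0; apply: nneg_eq0; apply: big1 => k _.
have [->//|jk] := eqVneq k j; have := evK _ k cE.
rewrite opp_lfunE nnegK eq_sym (negbTE jk) addr0 => /eqP.
by rewrite -addr_eq0 -natrD pnatr_eq0 addn_eq0 => /andP[/eqP].
Qed.

Variable e : 'I_n -> gC.
Hypotheses (e0 : forall j, e j != 0)
  (ew : forall j, weight (tnth alpha j) (e j)).

(** By [hnorm_lie], [conj e_j, w] = 0 gives a nonnegative value to the weight
    on h_j, that is, by [coroot_sym], to alpha_j on h_w. Summing with the
    nonnegative coefficients of the weight contradicts [coroot_self_lt0]. *)
Lemma no_lowest_vector c w : nneg c != 0 -> weight (nneg c) w ->
  (forall j, [lie conjg (e j), w] = 0) -> w = 0.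
Proof.
move=> c0 cw ejw; apply/eqP; apply: contraT => w0.
have [H wH] := exists_coroot gc tmax cw.
suff ge0 : 0 <= nneg c H.
  by have := le_lt_trans ge0 (coroot_self_lt0 gc c0 cw w0 wH); rewrite ltxx.
rewrite nnegE sumr_ge0 // => j _.
rewrite mulrn_wge0 //; have [H' jH] := exists_coroot gc tmax (ew j).
rewrite -(pmulr_lge0 _ (hnorm_gt0 gc (e0 j))) (coroot_sym (ew j) cw jH wH).
by rewrite -(hnorm_lie cw jH (ejw j)) hnorm_ge0.
Qed.

(** In other words, t_C, the e_j and their conjugates generate g_C. For v of positive weight, f v - v has the same weight and is killed by
    conj e_j, as f fixes [conj e_j, v] by induction on the height; so it
    vanishes by [no_lowest_vector]. Negative weights follow by conjugation. *)
Lemma simple_vectors_generate (f : 'End(g)) :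
    (forall x y, f [lie x, y] = [lie f x, f y]) ->
    {in t, forall x, f x = x} -> (forall j, cmap f (e j) = e j) -> f = \1%VF.
Proof.
move=> fL ft fe; have fi H : cmap f (cartan_incl H) = cartan_incl H.
  by rewrite /cmap /= !ft ?subvsP.
have pos s c z : (\sum_j c j <= s)%N -> weight (nneg c) z -> cmap f z = z.
  elim: s c z => [|s IHs] c z cs cz; have [c0|c0] := eqVneq (nneg c) 0.
  - by move: cz; rewrite c0 => /(weight0P tmax)[H ->].
  - by case/eqP: c0; apply: nneg_eq0; move: cs; rewrite leqn0 => /eqP.
  - by move: cz; rewrite c0 => /(weight0P tmax)[H ->].
  have cfz : weight (nneg c) (cmap f z).
    by move=> H; rewrite -fi -cmap_lie // cz cmapZ.
  pose w := (-1) *: z + cmap f z.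
  suff : w = 0 by rewrite /w scaleN1r addrC => /eqP; rewrite subr_eq0 => /eqP.
  apply: (no_lowest_vector c0 (weight_lin _ cz cfz)) => j.
  rewrite lieDr lieZr -{2}(fe j) -cmap_conjg -cmap_lie //.
  have jz : weight (nneg c - tnth alpha j) [lie conjg (e j), z].
    by rewrite addrC; apply: weight_lie cz; exact: weight_conjg.
  have [->|jz0] := eqVneq [lie conjg (e j), z] 0.
    by rewrite -(scale0r 0) cmapZ !scale0r scaler0 addr0.
  have [c' cE cc'] := nneg_sub_simple c0 jz0 jz.
  rewrite (IHs c') ?scaleN1r ?addNr //; last by rewrite -cE.
  by rewrite -ltnS (leq_trans cc').
apply: cmap_inj; apply: (weight_ind gc tmax) => [a z w zE wE|b z bz].
  by rewrite !cmapP zE wE.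
rewrite [RHS]/cmap !lfunE /= -[RHS]surjective_pairing.
have [->|z0] := eqVneq z 0.
  by rewrite -(scale0r 0) cmapZ !scale0r.
have [b0|b0] := eqVneq b 0.
  by move: bz; rewrite b0 => /(weight0P tmax)[H ->].
have [c [bc|bc]] := root_sign b0 z0 bz.
  by apply: (pos _ c) (leqnn _) _; rewrite -bc.
apply: (can_inj (@conjgK _ _)); rewrite -cmap_conjg.
apply: (pos _ c) (leqnn _) _; rewrite -[nneg c]opprK -bc.
exact: weight_conjg.
Qed.

End Simple.

(** * Exponentials of inner derivations *)

Section ExpRotation.
Variables (R : realType) (V : vectType R).

(** The orbit of x under A stays in the plane of x and y, where A is a times
    a quarter turn: the exponential series splits into those of cos and sin. *)
Lemma lfun_exp_rotation (A : 'End(V)) (a : R) (x y : V) :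
    A x = - (a *: y) -> A y = a *: x ->
  lfun_exp A x = cos a *: x - sin a *: y /\
  lfun_exp A y = cos a *: y + sin a *: x.
Proof.
move=> Ax Ay.
(* A^k x = c_k x - s_k y and A^k y = c_k y + s_k x *)
pose c k : R := (~~ odd k)%:R * (-1) ^+ k./2 * a ^+ k.
pose s k : R := (odd k)%:R * (-1) ^+ k.-1./2 * a ^+ k.
have cS k : c k.+1 = - (a * s k).
  rewrite /c /s /= negbK exprS; case: k => [|k] /=.
    by rewrite !mul0r mulr0 oppr0.
  by rewrite !exprS; ring.
have sS k : s k.+1 = a * c k.
  by rewrite /c /s /= exprS; ring.
have iterA k : iter k A x = c k *: x - s k *: y /\
    iter k A y = c k *: y + s k *: x.
  elim: k => [|k [IHx IHy]].
    by rewrite /c /s /= !mul0r !scale0r !mulr1 !scale1r subr0 addr0.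
  rewrite !iterS IHx IHy linearB linearD !linearZ /= Ax Ay cS sS.
  by split; apply: v2rP => l; rewrite !v2rE; ring.
pose e := vbasis {:V}.
have lim_exp (f : nat -> V) (z : V) p q (u v : V) : f = (fun k => iter k A z) ->
    (forall k, f k = (p * c k) *: u + (q * s k) *: v) ->
  lfun_exp A z = (p * cos a) *: u + (q * sin a) *: v.
  move=> -> fE; rewrite lfun_expE /exp_fun.
  rewrite [in RHS](coord_vbasis (memvf u)) [in RHS](coord_vbasis (memvf v)).
  rewrite !scaler_sumr -big_split /=; apply: eq_bigr => j _.
  rewrite !scalerA -scalerDl; congr (_ *: _).
  set U := coord _ j u; set W := coord _ j v.
  have -> : (fun k => coord (vbasis {:V}) j (iter k A z) / k`!%:R : R) =
     (p * U) *: cos_coeff a + (q * W) *: sin_coeff a.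
    apply/funext => k; rewrite fE linearD !linearZ /=.
    rewrite !fctE /GRing.scale /= -/U -/W /c /s /cos_coeff /sin_coeff /=.
    rewrite -!exprnP; ring.
  have cc := @is_cvg_series_cos_coeff R a.
  have cs := @is_cvg_series_sin_coeff R a.
  rewrite seriesD !seriesZ limD; [|exact: is_cvgZl_tmp|exact: is_cvgZl_tmp].
  rewrite !limZl_tmp // /GRing.scale /= -[X in _ * U * X]/(lim _).
  rewrite cos.unlock sin.unlock; ring.
split.
  rewrite (lim_exp _ x 1 (-1) x y erefl) ?mul1r ?mulN1r ?scaleNr // => k.
  by rewrite (iterA k).1 mul1r mulN1r scaleNr.
rewrite (lim_exp _ y 1 1 y x erefl) ?mul1r // => k.
by rewrite (iterA k).2 !mul1r.
Qed.

End ExpRotation.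

Section AdExp.
Local Open Scope complex_scope.
Variables (R : realType) (g : lieAlgType R) (t : {vspace g}).
Hypotheses (gc : compact_lie g) (tmax : maximal_abelian t).
Local Notation gC := (complexification g).

Lemma cmap_Ad_exp (x : g) (z : gC) (a : R) :
  [lie ((x, 0) : gC), z] = (0 +i* a) *: z ->
  cmap (Ad_exp x) z = (cos a +i* sin a) *: z.
Proof.
case: z => y y' E.
have [E1 E2] : [lie x, y] = - (a *: y') /\ [lie x, y'] = a *: y.
  have : clie (x, 0) (y, y') = Defs.cscale (0 +i* a) (y, y') := E.
  by case; rewrite /= !lie0l subr0 addr0 !scale0r !add0r.
rewrite -!adE in E1 E2.
by have [Ey Ey'] := lfun_exp_rotation E1 E2; congr pair.
Qed.

(** The exponential of ad x multiplies a vector of weight b by the character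
    e^(b x), so it respects brackets of weight vectors; these span g_C. *)
Lemma Ad_exp_lie (x : g) : x \in t ->
  forall y z, Ad_exp x [lie y, z] = [lie Ad_exp x y, Ad_exp x z].
Proof.
move=> xt; pose H : cartan t := (vsproj t x, 0).
have HE : cartan_incl H = (x, 0).
  by rewrite /cartan_incl /= vsprojK // linear0.
pose r (b : cartan_dual t) : R[i] :=
  cos (complex.Im (b H)) +i* sin (complex.Im (b H)).
have expE b z : weight b z -> cmap (Ad_exp x) z = r b *: z.
  move=> bz; have [->|z0] := eqVneq z 0.
    by rewrite -(scale0r 0) cmapZ !scale0r scaler0.
  apply: cmap_Ad_exp; rewrite -HE bz; congr (_ *: _).
  by apply/eqP; rewrite eq_complex /= eqxx andbT (weight_imaginary gc _ z0 bz).
have rD b d : r (b + d) = r b * r d.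
  rewrite /r add_lfunE; case: (b H) => p q; case: (d H) => p' q' /=.
  apply/eqP; rewrite eq_complex /= cosD sinD.
  by apply/andP; split; apply/eqP; ring.
suff expC : forall z w : gC,
    cmap (Ad_exp x) [lie z, w] = [lie cmap (Ad_exp x) z, cmap (Ad_exp x) w].
  move=> y z; have := congr1 fst (expC (y, 0) (z, 0)).
  by rewrite /= !lie0r !linear0 !lie0r !subr0 ?oppr0 ?addr0.
apply: (weight_ind gc tmax) => [a z z' zE z'E w|b z bz].
  by rewrite lieDl lieZl !cmapP lieDl lieZl zE z'E.
apply: (weight_ind gc tmax) => [a w w' wE w'E|d w dw].
  by rewrite lieDr lieZr !cmapP lieDr lieZr wE w'E.
rewrite (expE _ _ (weight_lie bz dw)) (expE _ _ bz) (expE _ _ dw).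
by rewrite lieZl lieZr scalerA rD.
Qed.

Lemma Ad_exp_coweight n (alpha : n.-tuple (cartan_dual t))
    (K : 'I_n -> cartan t) (a : R) (i j : 'I_n) (z : gC) :
    is_simple_system alpha ->
    (forall j k, tnth alpha j (K k) = (j == k)%:R) ->
    weight (tnth alpha j) z ->
  cmap (Ad_exp (a *: vsval (realpart ('i *: K i)))) z =
    (if j == i then cos a +i* sin a else 1) *: z.
Proof.
move=> alpha_simple alphaK jz; set x := a *: _.
have xE : cartan_incl ((0 +i* a) *: K i) = (x, 0).
  have -> : (0 +i* a) *: K i = a%:C *: ('i *: K i).
    rewrite scalerA; congr (_ *: _).
    by apply/eqP; rewrite eq_complex /=; apply/andP; split; apply/eqP; ring.
  rewrite (coweight_imaginary gc alpha_simple alphaK i) /x.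
  move: (realpart _) => p; rewrite /cartan_incl.
  by apply: (congr2 pair); rewrite /= ?scale0r ?scaler0 ?subr0 ?addr0.
have xz : [lie (x, 0) : gC, z] = (0 +i* (a *+ (j == i))) *: z.
  rewrite -xE jz linearZ /= alphaK; congr (_ *: _).
  by rewrite /GRing.scale /= mulr_natr; case: (j == i); rewrite ?mulr0n ?mulr1n.
rewrite (cmap_Ad_exp xz).
by case: (j == i); rewrite ?mulr0n ?mulr1n ?cos0 ?sin0.
Qed.

End AdExp.

Lemma lie_inverse (F : fieldType) (g : lieAlgType F) (mu : 'End(g)) :
    lie_automorphism mu ->
  forall x y, (mu^-1)%VF [lie x, y] = [lie (mu^-1)%VF x, (mu^-1)%VF y].
Proof.
case=> /eqP mu0 muL x y; apply: (lker0P mu0).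
by rewrite muL !lker0_lfunVK.
Qed.

Lemma lie_comp (F : fieldType) (g : lieAlgType F) (f f' : 'End(g)) :
    (forall x y, f [lie x, y] = [lie f x, f y]) ->
    (forall x y, f' [lie x, y] = [lie f' x, f' y]) ->
  forall x y, (f \o f')%VF [lie x, y] = [lie (f \o f')%VF x, (f \o f')%VF y].
Proof. by move=> fL f'L x y; rewrite !comp_lfunE f'L fL. Qed.

(** * Automorphisms determined by simple root vectors *)

Section Rigidity.
Local Open Scope complex_scope.
Variables (R : realType) (g : lieAlgType R) (t : {vspace g}).
Variables (n : nat) (alpha : n.-tuple (cartan_dual t)) (K : 'I_n -> cartan t).
Hypotheses (gc : compact_lie g) (tmax : maximal_abelian t).
Hypotheses (alpha_simple : is_simple_system alpha)
  (alphaK : forall j k, tnth alpha j (K k) = (j == k)%:R).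
Local Notation gC := (complexification g).

(** On e_i, tau acts by a scalar c with c^4 = 1. The hypothesis that
    tau^2 is not 1 excludes c = 1 and c = -1, and the other two values are those
    of sigma and of its inverse. *)
Lemma order4_rigid (e : 'I_n -> gC) (i : 'I_n) (sigma tau : 'End(g)) :
    (forall j, e j != 0) -> (forall j, weight (tnth alpha j) (e j)) ->
    (forall x y, sigma [lie x, y] = [lie sigma x, sigma y]) ->
    (forall x y, tau [lie x, y] = [lie tau x, tau y]) ->
    {in t, forall x, sigma x = x} -> {in t, forall x, tau x = x} ->
    (forall j, j != i -> cmap sigma (e j) = e j) ->
    (forall j, j != i -> cmap tau (e j) = e j) ->
    cmap sigma (e i) = 'i *: e i ->
    (tau \o tau)%VF != \1%VF ->
    ((sigma \o sigma) \o (sigma \o sigma) = \1 ->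
     (tau \o tau) \o (tau \o tau) = \1)%VF ->
  tau = sigma \/ tau = (sigma^-1)%VF.
Proof.
move=> e0 ew sL tL st tt se te sei t2 st4.
pose good (f : 'End(g)) := (forall x y, f [lie x, y] = [lie f x, f y]) /\
  {in t, forall x, f x = x} /\ (forall j, j != i -> cmap f (e j) = e j).
have gs : good sigma by [].
have gt : good tau by [].
have goodM f f' : good f -> good f' -> good (f \o f')%VF.
  move=> [fL [ft fe]] [f'L [f't f'e]]; split; first exact: lie_comp.
  split=> [x xt|j ji]; first by rewrite comp_lfunE f't // ft.
  by rewrite cmap_comp f'e // fe.
have good1 f : good f -> cmap f (e i) = e i -> f = \1%VF.
  move=> [fL [ft fe]] fei.
  apply: (simple_vectors_generate gc tmax alpha_simple alphaK e0 ew fL ft) => j.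
  by have [->|] := eqVneq j i; [exact: fei | exact: fe].
have i2 : 'i * 'i = -1 :> R[i] by rewrite -expr2 sqr_i.
have s4 : ((sigma \o sigma) \o (sigma \o sigma))%VF = \1%VF.
  apply: good1; first exact: goodM (goodM _ _ gs gs) (goodM _ _ gs gs).
  by rewrite !cmap_comp !(cmapZ, sei) !scalerA -mulrA i2 mulN1r opprK scale1r.
have t4 := st4 s4.
have [c tei] : exists c, cmap tau (e i) = c *: e i.
  have [aB aR _] := alpha_simple.
  apply: (weight_colinear gc tmax _ (e0 i) (ew i)); first by case: (aR i).
  move=> H; have <- : cmap tau (cartan_incl H) = cartan_incl H.
    by rewrite /cmap /= !tt ?subvsP.
  by rewrite -cmap_lie // ew cmapZ.
have c4 : (c ^+ 2 - 1) * (c ^+ 2 + 1) = 0.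
  have := congr1 (fun f => cmap f (e i)) t4.
  rewrite !cmap_comp !(cmapZ, tei) !scalerA [RHS]/cmap !lfunE /=.
  rewrite -surjective_pairing -[X in _ = X]scale1r => /eqP.
  rewrite -subr_eq0 -scalerBl scaler_eq0 (negbTE (e0 i)) orbF.
  by move/eqP <-; ring.
move/eqP: c4; rewrite mulf_eq0 => /orP[/eqP c2|/eqP c2].
  case/eqP: t2; apply: good1; first exact: goodM.
  rewrite cmap_comp tei cmapZ tei scalerA -expr2.
  by move/eqP: c2; rewrite subr_eq0 => /eqP ->; rewrite scale1r.
have : (c - 'i) * (c + 'i) = 0.
  by rewrite -c2 -[in RHS](opprK 1) -i2; ring.
move/eqP; rewrite mulf_eq0 subr_eq0 addr_eq0 => /orP[/eqP cE|/eqP cE].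
  left.
  (* sigma^3 stands for sigma^-1 *)
  have ts3 : (tau \o (sigma \o (sigma \o sigma)))%VF = \1%VF.
    apply: good1; first exact: goodM gt (goodM _ _ gs (goodM _ _ gs gs)).
    rewrite !cmap_comp !(cmapZ, sei, tei) !scalerA cE -mulrA i2.
    by rewrite mulN1r opprK scale1r.
  apply/lfunP => x; have /lfunP/(_ (sigma x)) := ts3; have /lfunP/(_ x) := s4.
  by rewrite !comp_lfunE !id_lfunE => ->.
right; have ts : (tau \o sigma)%VF = \1%VF.
  apply: good1; first exact: goodM.
  by rewrite cmap_comp sei cmapZ tei scalerA cE mulrN i2 opprK scale1r.
have sI : lker sigma == 0%VS.
  apply/lker0P; apply: (can_inj (g := (sigma \o (sigma \o sigma))%VF)) => x.
  by have /lfunP/(_ x) := s4; rewrite !comp_lfunE id_lfunE.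
by rewrite -[tau](lker0_compfK sI) ts comp_lfun1l.
Qed.

End Rigidity.

Theorem lemma3p1 (R : realType) (g : lieAlgType R)
    (t : {vspace g}) (n : nat) (alpha : n.-tuple (cartan_dual t))
    (delta : cartan_dual t) (m : 'I_n -> nat) (K : 'I_n -> cartan t)
    (i : 'I_n) (sigma : 'End(g)) (h : {vspace g}) :
  compact_lie g -> simple_lie g ->
  maximal_abelian t -> (t <= h)%VS ->
  is_simple_system alpha ->
  is_highest_root alpha delta -> delta = \sum_j tnth alpha j *+ m j ->
  (forall j k, tnth alpha j (K k) = (j == k)%:R) ->
  m i = 3%N \/ m i = 4%N ->
  sigma = Ad_exp ((pi / 2) *: vsval (realpart ('i%C *: K i))) ->
  h = fixedSpace sigma ->
  forall mu : 'End(g), lie_automorphism mu -> (mu @: h)%VS = h ->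
    (mu \o sigma \o mu^-1)%VF = sigma \/
    (mu \o sigma \o mu^-1)%VF = (sigma^-1)%VF.
Proof.
move=> gc _ tmax th alpha_simple _ _ alphaK _ sE hE mu muA muh.
have [/eqP mu0 muL] := muA.
have /boolp.choice[e eP] : forall j, exists Z : complexification g,
    Z != 0 /\ weight (tnth alpha j) Z.
  have [_ aR _] := alpha_simple; move=> j.
  by have [_ [Z Z0 ZP]] := aR j; exists Z.
have e0 j : e j != 0 := (eP j).1.
have ew j : weight (tnth alpha j) (e j) := (eP j).2.
pose x := (pi / 2) *: vsval (realpart ('i%C *: K i)).
have xt : x \in t by rewrite rpredZ // subvsP.
have sL : forall y z, sigma [lie y, z] = [lie sigma y, sigma z].
  by rewrite sE; exact: (Ad_exp_lie gc tmax xt).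
have hs y : y \in h -> sigma y = y by rewrite hE => /fixedSpaceP.
have se j : cmap sigma (e j) = (if j == i then 'i%C else 1) *: e j.
  rewrite sE (Ad_exp_coweight gc _ _ alpha_simple alphaK (ew j)).
  by rewrite cos_pihalf sin_pihalf.
have se1 j : j != i -> cmap sigma (e j) = e j.
  by move=> /negbTE ji; rewrite se ji scale1r.
have sei : cmap sigma (e i) = 'i%C *: e i by rewrite se eqxx.
pose tau := (mu \o sigma \o mu^-1)%VF.
have th1 y : y \in h -> tau y = y.
  rewrite -{1}muh => /memv_imgP[y' y'h ->].
  by rewrite !comp_lfunE lker0_lfunK // hs.
have tauM f f' : ((mu \o f \o mu^-1) \o (mu \o f' \o mu^-1) =
    mu \o (f \o f') \o mu^-1)%VF.
  by apply/lfunP => y; rewrite !comp_lfunE lker0_lfunK.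
have mu1 : (mu \o \1 \o mu^-1)%VF = \1%VF.
  by rewrite comp_lfun1r lker0_compfV.
apply: (order4_rigid gc tmax alpha_simple alphaK e0 ew sL _ _ _ se1 _ sei).
- apply: lie_comp (lie_inverse muA); exact: lie_comp.
- by move=> y /(subvP th)/hs.
- by move=> y /(subvP th)/th1.
- move=> j /se1 sj; rewrite [RHS]surjective_pairing.
  congr pair; apply: th1; rewrite hE.
    by apply/fixedSpaceP; exact: (congr1 fst sj).
  by apply/fixedSpaceP; exact: (congr1 snd sj).
- rewrite tauM; apply/eqP => /lfunP s2.
  have {}s2 : (sigma \o sigma)%VF = \1%VF.
    apply/lfunP => y; have := s2 (mu y).
    by rewrite !comp_lfunE !id_lfunE !lker0_lfunK // => /(lker0P mu0).
  have := congr1 (fun f => cmap f (e i)) s2.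
  rewrite cmap_comp sei cmapZ sei scalerA -expr2 sqr_i scaleN1r.
  rewrite [RHS]/cmap !id_lfunE -surjective_pairing => /eqP.
  rewrite eq_sym -addr_eq0 -mulr2n -scaler_nat scaler_eq0 (negbTE (e0 i)) orbF.
  by rewrite pnatr_eq0.
- by rewrite !tauM => ->.
Qed.
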